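(* Let $\mathbb{X}$ be a finite-dimensional real Banach space. Let $(\mu_n)_{n\in\mathbb N}$ be a sequence of probability measures on $\mathbb X$ such that $\mu_n\stackrel{w}{\to}\mu$ (weak convergence), where $\mu$ is a probability measure on $\mathbb X$. Assume that $\mu$ possesses a unique geometric quantile $\mathbf y^*_{\mathbf u}$ (for each parameter $\mathbf u\in\mathbb X^*$ with $\|\mathbf u\|_{\mathbb X^*}<1$). Let $\mathbf y^*_{n,\mathbf u}$ be a geometric quantile of $\mu_n$ with parameter $\mathbf u$. Then for any $\varepsilon>0$, $$\sup_{\|\mathbf u\|_{\mathbb X^*}<1-\varepsilon}\|\mathbf y^*_{n,\mathbf u}-\mathbf y^*_{\mathbf u}\|_{\mathbb X}\to0\quad\text{as } n\to\infty.$$ Further, if $\mu$ is atomless, then for any $c_n\to0$ and any $\mathbf v\in\mathbb X^*$ with $\|\mathbf v\|_{\mathbb X^*}<1$, $$\sup_{\|\mathbf u-\mathbf v\|_{\mathbb X^*}\le c_n}\|\mathbf y^*_{n,\mathbf u}-\mathbf y^*_{\mathbf v}\|_{\mathbb X}\to0\quad\text{as } n\to\infty.$$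
   Context: For a probability measure $\nu$ on $\mathbb X$ and $\mathbf u\in\mathbb X^*$ with $\|\mathbf u\|_{\mathbb X^*}<1$, a geometric quantile of $\nu$ with parameter $\mathbf u$ is a minimizer over $\mathbf y\in\mathbb X$ of $\int(\|\mathbf y-\mathbf x\|_{\mathbb X}-\|\mathbf x\|_{\mathbb X})\,\nu(d\mathbf x)-\langle\mathbf u,\mathbf y\rangle$. Here $c_n$ are non-negative constants. *)

(* Defs.v *)
From HB Require Import structures.
From mathcomp Require Import all_boot all_order all_algebra.
From mathcomp Require Import all_classical all_reals all_analysis.

Set Implicit Arguments.
Unset Strict Implicit.
Unset Printing Implicit Defensive.

Import Order.TTheory GRing.Theory Num.Theory.
Import numFieldNormedType.Exports.

Local Open Scope classical_set_scope.
Local Open Scope ring_scope.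

Notation borel X := (g_sigma_algebraType (@open X)).

Definition finite_dimensional (R : realType) (X : lmodType R) : Prop :=
  exists (n : nat) (e : 'I_n -> X),
    forall x : X, exists a : 'I_n -> R, x = \sum_(i < n) a i *: e i.

Record dual (R : realType) (X : normedModType R) := Dual {
  dual_fun :> {scalar X};
  dual_continuous : continuous (dual_fun : X -> R) }.

(* The set is nonempty, and bounded above when f is a continuous linear
   functional, so that the real-valued [sup] takes no default value on [dual X]
   or on differences of its elements. *)
Definition dual_norm (R : realType) (X : normedModType R) (f : X -> R) : R :=
  sup [set `|f x| | x in [set x : X | `|x| <= 1]].

(* The integrand is continuous and bounded by `|y|, hence integrable. *)
Definition quantile_objective (R : realType) (X : normedModType R)
    (nu : probability (borel X) R) (u : dual X) (y : X) : R :=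
  (\int[nu]_x (`|y - (x : X)| - `|(x : X)|)) - u y.

Definition geometric_quantile (R : realType) (X : normedModType R)
    (nu : probability (borel X) R) (u : dual X) (y : X) : Prop :=
  forall z : X, quantile_objective nu u y <= quantile_objective nu u z.

Definition weak_cvg (R : realType) (X : normedModType R)
    (mu_ : nat -> probability (borel X) R) (mu : probability (borel X) R) :
    Prop :=
  forall f : X -> R, continuous f -> bounded_fun f ->
    (fun n => \int[mu_ n]_x f x) @ \oo --> \int[mu]_x f x.

Definition atomless (R : realType) d (T : measurableType d)
    (mu : {measure set T -> \bar R}) : Prop :=
  forall A : set T, measurable A -> (0 < mu A)%E ->
    exists B : set T, [/\ measurable B, B `<=` A & (0 < mu B < mu A)%E].

(* Supremum in [0, +oo], so that the supremum of the empty set is 0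
   (whereas [ereal_sup set0 = -oo]). *)
Definition nneg_sup (R : realType) (S : set (\bar R)) : \bar R :=
  ereal_sup (0%E |` S).

(* Main.v *)
Require Import Defs.
From HB Require Import structures.
From mathcomp Require Import all_boot all_order all_algebra.
From mathcomp Require Import all_classical all_reals all_analysis.
From mathcomp Require Import lra.

Set Implicit Arguments.
Unset Strict Implicit.
Unset Printing Implicit Defensive.

Import Order.TTheory GRing.Theory Num.Theory.
Import numFieldNormedType.Exports.

Local Open Scope classical_set_scope.
Local Open Scope ring_scope.

(** The statement is a stability property of the minimizers of the objective
    Phi(nu, u, y) = int (|y - x| - |x|) nu(dx) - u(y). For fixed y its integrand
    is continuous and bounded by |y|, so weak convergence of nu_i and pointwise
    convergence of u_i give convergence of Phi(nu_i, u_i, y); moreover Phi is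
    Lipschitz in y, with constant 1 + r when |u| <= r ([quantile_objective_le]).
    Hence a limit of minimizers is a minimizer of the limit objective
    ([geometric_quantile_limit]).

    Minimizers do have limits. Let g_k(x) = min(1, |x| / (k + 1)). Then
    Phi(nu, u, y) >= (1 - r - 2 int g_k dnu) |y| - 2 (k + 1), while the minimum is
    at most Phi(nu, u, 0) = 0. Since int g_k dmu tends to 0 as k grows, and the
    g_k are themselves test functions for weak convergence, some k makes
    int g_k dnu_i < (1 - r) / 4 for all late i; this bounds the minimizers
    uniformly in the parameters with |u| <= r < 1 ([near_quantile_bounded]). In
    finite dimension closed balls are compact ([closed_norm_ball_compact]).

    Uniformity in u is obtained by compactness, in the form of ultrafilters on
    nat instead of subsequences: the suprema tend to 0 as soon as, for every
    ultrafilter U refining the filter of cofinite sets and every choice of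
    parameters u_n, the quantity at u_n tends to 0 along U
    ([nneg_sup_ultra_cvg0]). Along U everything bounded converges: the u_n
    converge pointwise to a functional u with the same bound
    ([dual_ultra_limit]), and the quantiles of mu_n with parameter u_n converge to
    a quantile of mu with parameter u, that is, to y*_u. The same argument with
    the constant sequence mu shows that y*_(u_n) tends to y*_u, which proves the
    first claim; for the second one, the limit of the u_n is v. *)

(** * Integrals of bounded continuous functions *)

Lemma continuous_measurable_borel (T : ptopologicalType) (R : realType)
    (f : T -> R) :
  continuous f -> measurable_fun [set: borel T] (f : borel T -> R).
Proof.
move=> /continuousP cf.
apply: (measurability _ (measurable_realfun.RGenOpens.measurableE R)).
move=> _ [_ [a [b ->] <-]]; rewrite setTI.
by apply: sub_gen_smallest; apply: cf; exact: interval_open.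
Qed.

Lemma bounded_continuous_integrable (R : realType) (X : normedModType R)
    (nu : probability (borel X) R) (f : X -> R) :
  continuous f -> bounded_fun f -> nu.-integrable [set: borel X] (EFin \o f).
Proof.
move=> cf bf; apply: measurable_bounded_integrable => //.
- by rewrite (le_lt_trans (probability_le1 _ _)) ?ltry.
- exact: continuous_measurable_borel.
Qed.

Lemma le_bounded_fun (T : Type) (R : realType) (f : T -> R) (M : R) :
  (forall x, `|f x| <= M) -> bounded_fun f.
Proof.
move=> fM; exists M; split=> [|y My x _ /=]; first exact: num_real.
exact: le_trans (fM x) (ltW My).
Qed.

Lemma constant_prob_integrable (R : realType) (X : normedModType R)
    (nu : probability (borel X) R) (r : R) :
  nu.-integrable [set: borel X] (EFin \o (fun=> r)).
Proof.
apply: bounded_continuous_integrable; first exact: cst_continuous.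
exact: (@le_bounded_fun _ _ _ `|r|).
Qed.

Lemma Rintegral_prob_cst (R : realType) (X : normedModType R)
    (nu : probability (borel X) R) (r : R) : \int[nu]_x r = r.
Proof.
rewrite Rintegral_cst// [X in fine X](_ : _ = 1%E) ?mulr1//.
exact: (@probability_setT _ _ _ nu).
Qed.

(** * The quantile objective *)

Section objective.
Context (R : realType) (X : normedModType R).
Implicit Types (nu : probability (borel X) R) (u : dual X) (x y z : X).

Lemma dist_gain_continuous y : continuous (fun x : X => `|y - x| - `|x|).
Proof.
move=> x; apply: cvgB; apply: cvg_norm; last exact: cvg_id.
by apply: cvgB; [exact: cvg_cst|exact: cvg_id].
Qed.

Lemma dist_gain_le y x : `| `|y - x| - `|x| | <= `|y|.
Proof.
rewrite (distrC y x) (le_trans (ler_dist_dist _ _))//.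
by rewrite addrAC subrr sub0r normrN.
Qed.

Lemma dist_gain_bounded y : bounded_fun (fun x : X => `|y - x| - `|x|).
Proof. exact/le_bounded_fun/dist_gain_le. Qed.

Lemma dist_gain_integrable nu y :
  nu.-integrable [set: borel X] (EFin \o (fun x : X => `|y - x| - `|x|)).
Proof.
apply: bounded_continuous_integrable.
- exact: dist_gain_continuous.
- exact: dist_gain_bounded.
Qed.

Lemma quantile_objective0 nu u : quantile_objective nu u 0 = 0.
Proof.
rewrite /quantile_objective linear0 subr0.
under eq_Rintegral do rewrite sub0r normrN subrr.
by rewrite Rintegral_prob_cst.
Qed.

(** The objective inherits the constant 1 of y |-> |y - x|, and r of u. The form
    without absolute value is what allows y to be replaced by a nearby z in a
    minimality inequality. *)
Lemma quantile_objective_le nu u (r : R) y z :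
  (forall x, `|u x| <= r * `|x|) ->
  quantile_objective nu u y <= quantile_objective nu u z + (1 + r) * `|y - z|.
Proof.
move=> ur; rewrite /quantile_objective.
have uyz : u z - u y <= r * `|y - z|.
  by rewrite -linearB (le_trans (ler_norm _))// (le_trans (ur _))// distrC.
suff : \int[nu]_x (`|y - (x : X)| - `|(x : X)|) <=
    \int[nu]_x (`|z - (x : X)| - `|(x : X)|) + `|y - z| by lra.
rewrite -[X in _ + X](Rintegral_prob_cst nu).
rewrite -RintegralD//; last 2 first.
- exact: dist_gain_integrable.
- exact: constant_prob_integrable.
apply: le_Rintegral => //.
- exact: dist_gain_integrable.
- apply: bounded_continuous_integrable.
    move=> x; apply: cvgD; last exact: cvg_cst.
    exact: dist_gain_continuous.
  apply: (@le_bounded_fun _ _ _ (`|z| + `|y - z|)) => x.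
  by rewrite (le_trans (ler_normD _ _))// normr_id lerD2r dist_gain_le.
- by move=> x _; have := ler_distD z y x; lra.
Qed.

End objective.

(** * A coercive lower bound *)

Section tightness.
Context (R : realType) (X : normedModType R).
Implicit Types (nu : probability (borel X) R) (u : dual X) (x y z : X).

(** A continuous majorant of the indicator of |x| > k + 1: mass far from 0 has to
    be measured by a bounded continuous function for weak convergence to control
    it. *)
Definition soft_far (k : nat) (x : X) : R := Num.min 1 (`|x| / k.+1%:R).

Lemma soft_far_ge0 k x : 0 <= soft_far k x.
Proof. by rewrite le_min ler01 divr_ge0. Qed.

Lemma soft_far_le1 k x : `|soft_far k x| <= 1.
Proof. by rewrite ger0_norm ?soft_far_ge0// ge_min lexx. Qed.

Lemma soft_far_continuous k : continuous (soft_far k).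
Proof.
move=> x; apply: (@continuous_min _ _ (cst 1) (fun z : X => `|z| / k.+1%:R)).
  exact: cvg_cst.
by apply: cvgMr_tmp; apply: cvg_norm; exact: cvg_id.
Qed.

Lemma soft_far_bounded k : bounded_fun (soft_far k).
Proof. exact/le_bounded_fun/soft_far_le1. Qed.

Lemma soft_far_integrable nu k :
  nu.-integrable [set: borel X] (EFin \o soft_far k).
Proof.
apply: bounded_continuous_integrable.
- exact: soft_far_continuous.
- exact: soft_far_bounded.
Qed.

Lemma soft_far_cvg0 x : soft_far k x @[k --> \oo] --> 0.
Proof.
apply: (@squeeze_cvgr _ _ _ _ (cst 0) (fun k => `|x| / k.+1%:R)).
- by near=> k; rewrite soft_far_ge0/= ge_min lexx orbT.
- exact: cvg_cst.
- rewrite -[X in _ --> X](mulr0 `|x|).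
  by apply: cvgMl_tmp; exact: cvg_harmonic.
Unshelve. all: by end_near. Qed.

Lemma Rintegral_soft_far_cvg0 nu : \int[nu]_x soft_far k x @[k --> \oo] --> 0.
Proof.
have [||||||_ _ far_cvg] := @dominated_convergence _ _ _ nu [set: borel X] _
  (fun k => EFin \o soft_far k) (cst 0%E) (cst 1%E).
- exact: measurableT.
- by move=> k; exact: measurable_int (soft_far_integrable nu k).
- exact: measurable_cst.
- by apply: aeW => x _; apply: cvg_EFin; [exact: nearW|exact: soft_far_cvg0].
- exact: (constant_prob_integrable nu 1).
- by apply: aeW => x k _; rewrite lee_fin soft_far_le1.
rewrite integral_cst// mul0e in far_cvg.
exact: fine_cvg far_cvg.
Qed.

(** When |x| <= k + 1 the gain is at least |y| - 2 (k + 1); otherwise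
    [soft_far k x = 1] and the trivial lower bound - |y| is enough. *)
Lemma dist_gain_ge k y x :
  (1 - 2 * soft_far k x) * `|y| - 2 * k.+1%:R <= `|y - x| - `|x|.
Proof.
rewrite /soft_far; set h := Num.min _ _.
have yx : `|y| <= `|y - x| + `|x| by rewrite -{1}(subrK x y) ler_normD.
have xy : `|x| <= `|y - x| + `|y| by rewrite distrC -{1}(subrK y x) ler_normD.
have h0 : 0 <= h := soft_far_ge0 k x.
have K0 : 0 < k.+1%:R :> R by [].
have [xk|kx] := leP `|x| k.+1%:R.
  have : 0 <= h * `|y| by exact: mulr_ge0.
  nra.
have -> : h = 1 by apply/min_idPl; rewrite ler_pdivlMr// mul1r ltW.
lra.
Qed.

Lemma quantile_objective_ge nu u (r : R) k y :
  (forall x, `|u x| <= r * `|x|) ->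
  (1 - r - 2 * \int[nu]_x soft_far k x) * `|y| - 2 * k.+1%:R
    <= quantile_objective nu u y.
Proof.
move=> ur; rewrite /quantile_objective.
have uy : u y <= r * `|y| by rewrite (le_trans (ler_norm _)).
suff : (- 2 * `|y|) * \int[nu]_x soft_far k x + (`|y| - 2 * k.+1%:R)
    <= \int[nu]_x (`|y - (x : X)| - `|(x : X)|) by lra.
rewrite -[X in _ + X](Rintegral_prob_cst nu) -RintegralZl//; last first.
  exact: soft_far_integrable.
rewrite -RintegralD//; last 2 first.
- apply: bounded_continuous_integrable.
    by move=> x; apply: cvgMl_tmp; exact: soft_far_continuous.
  apply: (@le_bounded_fun _ _ _ (2 * `|y|)) => x.
  rewrite !normrM normrN normr_id (@ger0_norm _ 2)//.
  by rewrite ler_piMr ?soft_far_le1// mulr_ge0.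
- exact: constant_prob_integrable.
apply: le_Rintegral => //.
- apply: bounded_continuous_integrable.
    move=> x; apply: cvgD; last exact: cvg_cst.
    by apply: cvgMl_tmp; exact: soft_far_continuous.
  apply: (@le_bounded_fun _ _ _ (2 * `|y| + `| `|y| - 2 * k.+1%:R|)) => x.
  rewrite (le_trans (ler_normD _ _))// lerD2r !normrM normrN normr_id.
  rewrite (@ger0_norm _ 2)// ler_piMr ?soft_far_le1// mulr_ge0//.
- exact: dist_gain_integrable.
- by move=> x _; have := dist_gain_ge k y x; lra.
Qed.

End tightness.

(** * Compactness of closed balls in finite dimension *)

(** A generating family of least size is free: a nontrivial relation would allow
    a vector to be expressed by the others, leaving a smaller generating family. *)
Lemma minimal_generating_family (R : realType) (X : lmodType R) :
  finite_dimensional X ->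
  exists (n : nat) (e : 'I_n -> X),
    (forall x : X, exists a : 'I_n -> R, x = \sum_(i < n) a i *: e i) /\
    (forall a : 'I_n -> R, \sum_(i < n) a i *: e i = 0 -> forall i, a i = 0).
Proof.
move=> finX.
pose gen n := exists e : 'I_n -> X,
  forall x : X, exists a : 'I_n -> R, x = \sum_(i < n) a i *: e i.
have exn : exists n, `[< gen n >].
  by case: finX => n gn; exists n; exact/asboolP.
case: (ex_minnP exn) => n /asboolP[e e_gen] n_min.
exists n, e; split=> // a a0 j; apply/eqP/contraT => aj0.
case: n => [|n] in e e_gen n_min a a0 j aj0 *; first by case: j {aj0}.
suff /asboolP/n_min : gen n by rewrite ltnn.
exists (e \o lift j) => x; have [b ->] := e_gen x.
exists (fun i => b (lift j i) - b j * (a j)^-1 * a (lift j i)).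
move: a0; rewrite !(bigD1_ord j)//= => /eqP; rewrite addr_eq0 => /eqP a0.
have -> : e j = - (a j)^-1 *: \sum_(i < n) a (lift j i) *: e (lift j i).
  by rewrite scaleNr -scalerN -a0 scalerA mulVf// scale1r.
rewrite !scaler_sumr -big_split/=; apply: eq_bigr => i _.
by rewrite !scalerA scalerBl addrC mulrN mulNr scaleNr.
Qed.

(** The linear combination map of a basis is bounded below on the unit sphere,
    which is compact; so a ball of X is a closed subset of the image of a ball of
    coordinates. *)
Lemma closed_norm_ball_compact (R : realType) (X : normedModType R) (r : R) :
  finite_dimensional X -> compact [set x : X | `|x| <= r].
Proof.
move=> /minimal_generating_family[n [e [e_gen e_free]]].
pose comb (a : 'rV[R]_n) : X := \sum_(i < n) a ord0 i *: e i.
have comb_cont : continuous comb.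
  apply: continuous_big => [x|i _ a]; first exact: add_continuous.
  apply: (@continuous_comp _ _ _ (fun a : 'rV[R]_n => a ord0 i)
    ( *:%R^~ (e i))).
    exact: coord_continuous.
  exact: scalel_continuous.
have combZ t a : comb (t *: a) = t *: comb a.
  by rewrite /comb scaler_sumr; apply: eq_bigr => i _; rewrite mxE scalerA.
have comb0 a : comb a = 0 -> a = 0.
  by move=> /e_free a0; apply/rowP => i; rewrite a0 mxE.
have [m m0 comb_ge] : exists2 m, 0 < m & forall a, m * `|a| <= `|comb a|.
  pose S := [set a : 'rV[R]_n | `|a| = 1].
  have normal a : a != 0 -> S (`|a|^-1 *: a).
    move=> a0; rewrite /S/= normrZ normfV normr_id mulVf//.
    by rewrite normr_eq0.
  have [[a1 Sa1]|S0] := pselect (S !=set0); last first.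
    exists 1 => // a; have [->|a0] := eqVneq a 0; first by rewrite normr0 mulr0.
    by exfalso; apply: S0; exists (`|a|^-1 *: a); exact: normal.
  have S_compact : compact S.
    apply: bounded_closed_compact.
      by exists 1; split=> // y y1 a /= ->; exact: ltW.
    rewrite (_ : S = (fun a => `|a|) @^-1` [set 1])//.
    apply: closed_comp => [a _|]; last exact: closed_eq.
    exact: norm_continuous.
  have [|c] := EVT_min_rV (ex_intro _ _ Sa1) S_compact
    (f := fun a => `|comb a|).
    apply: continuous_subspaceT => a.
    apply: (@continuous_comp _ _ _ comb (fun x : X => `|x|)).
      exact: comb_cont.
    exact: norm_continuous.
  rewrite inE => Sc c_min; exists `|comb c|.
    rewrite normr_gt0; apply/eqP => /comb0 c0.
    by move: Sc; rewrite /S/= c0 normr0 => /esym/eqP; rewrite oner_eq0.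
  move=> a; have [->|a0] := eqVneq a 0; first by rewrite normr0 mulr0.
  have := c_min (`|a|^-1 *: a); rewrite inE => /(_ (normal _ a0)).
  by rewrite combZ normrZ normfV normr_id mulrC ler_pdivlMr ?normr_gt0.
apply: (@subclosed_compact _ _ (comb @` [set a | `|a| <= r / m])).
- rewrite (_ : [set _ | _] = (fun x : X => `|x|) @^-1` [set t | t <= r])//.
  apply: closed_comp => [a _|]; last exact: closed_le.
  exact: norm_continuous.
- apply: continuous_compact; first exact: continuous_subspaceT.
  apply: bounded_closed_compact.
    exists (r / m); split=> [|y y1 a /= ar]; first exact: num_real.
    exact: le_trans ar (ltW y1).
  rewrite (_ : [set _ | _] = (fun x : 'rV[R]_n => `|x|) @^-1`
    [set t | t <= r / m])//.
  apply: closed_comp => [a _|]; last exact: closed_le.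
  exact: norm_continuous.
- move=> x /= xr; have [a xa] := e_gen x; exists (\row_i a i).
    rewrite /= ler_pdivlMr// mulrC (le_trans (comb_ge _))//.
    by rewrite /comb; under eq_bigr do rewrite mxE; rewrite -xa.
  by rewrite /comb; under eq_bigr do rewrite mxE.
Qed.

(** * Ultrafilters and compactness *)

Lemma compact_ultra_cvg (I : Type) (T : topologicalType) (U : set_system I)
    (K : set T) (f : I -> T) :
  UltraFilter U -> compact K -> (\forall i \near U, K (f i)) ->
  exists2 p, K p & f @ U --> p.
Proof.
move=> UU cK UK; have [p [Kp clp]] := cK (f @ U) _ UK.
exists p => // A Ap; have [//|UnA] := in_ultra_setVsetC (f @^-1` A) UU.
by have [q [nAq /nAq]] := clp (~` A) A UnA Ap.
Qed.

(** A filter is the intersection of the ultrafilters that refine it; this turns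
    an eventual statement into one where subsequences need not be extracted. *)
Lemma near_ultra (I : Type) (F : set_system I) (P : set I) : Filter F ->
  (forall U, UltraFilter U -> F `<=` U -> U P) -> F P.
Proof.
move=> FF UP; apply: contrapT => nFP.
have Fn : ProperFilter (within (~` P) F).
  apply: Build_ProperFilter_ex => Q FQ; apply: contrapT => nQ; apply: nFP.
  apply: (filterS _ (FQ : F [set x | ~ P x -> Q x])) => x Qx.
  by apply: contrapT => nPx; apply: nQ; exists x; exact: Qx.
have [U [UU FU]] := ultraFilterLemma Fn.
have UPn : U (~` P) by apply: FU; exact: nearW.
have /(UP U UU) UPp : F `<=` U.
  by move=> Q FQ; apply: FU; apply: filterS FQ => x.
by have [x []] := filter_ex (filterI UPp UPn).
Qed.

(** * Continuous linear functionals *)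

Section dual_norm.
Context (R : realType) (X : normedModType R).
Implicit Types (u v : dual X) (x : X).

Lemma scalar_bound (f : {scalar X}) : continuous (f : X -> R) ->
  exists2 M, 0 <= M & forall x, `|f x| <= M * `|x|.
Proof.
move=> cf.
have /linear_boundedP f_bnd := continuous_linear_bounded (0 : X) (cf 0).
near +oo_R => M; exists M => //.
by near: M.
Unshelve. all: by end_near. Qed.

Lemma dual_norm_has_sup (f : {scalar X}) : continuous (f : X -> R) ->
  has_sup [set `|f x| | x in [set x : X | `|x| <= 1]].
Proof.
move=> /scalar_bound[M M0 fM]; split.
  by exists `|f 0|, 0 => //=; rewrite normr0.
by exists M => _ [x /= x1 <-]; rewrite (le_trans (fM x))// ler_piMr.
Qed.

Lemma dual_normP (f : {scalar X}) x : continuous (f : X -> R) ->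
  `|f x| <= dual_norm f * `|x|.
Proof.
move=> cf; have [->|x0] := eqVneq x 0; first by rewrite linear0 !normr0 mulr0.
rewrite -ler_pdivrMr ?normr_gt0//.
rewrite -[leLHS](_ : `|f (`|x|^-1 *: x)| = _); last first.
  by rewrite linearZ/= normrM normfV normr_id mulrC.
apply: (sup_upper_bound (dual_norm_has_sup cf)).
exists (`|x|^-1 *: x) => //=.
by rewrite normrZ normfV normr_id mulVf// normr_eq0.
Qed.

Lemma dual_norm_ge0 u : 0 <= dual_norm u.
Proof.
apply: (le_trans (normr_ge0 (u 0))).
apply: (sup_upper_bound (dual_norm_has_sup (@dual_continuous _ _ u))).
by exists 0 => //=; rewrite normr0.
Qed.

Lemma dual_norm_le u (r : R) : 0 <= r -> (forall x, `|u x| <= r * `|x|) ->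
  dual_norm u <= r.
Proof.
move=> r0 ur; apply: ge_sup.
  by exists `|u 0|, 0 => //=; rewrite normr0.
by move=> _ [x /= x1 <-]; rewrite (le_trans (ur x))// ler_piMr.
Qed.

Lemma dual_normBP u v x : `|u x - v x| <= dual_norm (u \- v) * `|x|.
Proof.
have := @dual_normP (u \- v) x; apply.
move=> z; apply: cvgB; exact: dual_continuous.
Qed.

(** Compactness of balls of the dual for pointwise convergence: every
    [u_ i x] stays in a segment, hence has a limit along [U], and these limits
    depend linearly on [x]. *)
Lemma dual_ultra_limit (I : Type) (U : set_system I) (u_ : I -> dual X)
    (r : R) :
  UltraFilter U -> (\forall i \near U, forall x, `|u_ i x| <= r * `|x|) ->
  exists2 u : dual X, (forall x, `|u x| <= r * `|x|) &
    forall x, u_ i x @[i --> U] --> u x.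
Proof.
move=> UU u_r.
have /choice[l u_l] : forall x, exists l : R, u_ i x @[i --> U] --> l.
  move=> x; have [||l _ ?] := @compact_ultra_cvg _ _ U
    `[- (r * `|x|), r * `|x|]%classic (fun i => u_ i x) UU; last by exists l.
    exact: segment_compact.
  by apply: filterS u_r => i /(_ x); rewrite /= in_itv/= ler_norml.
have l_lin : linear_for *%R l.
  move=> t x y; apply: (cvg_unique _ (u_l _)) => //.
  rewrite (_ : (fun i => _) = fun i => t * u_ i x + u_ i y); last first.
    by apply/funext => i; rewrite linearP.
  by apply: cvgD => //; apply: cvgMl_tmp.
have l_r x : `|l x| <= r * `|x|.
  apply: (cvgr_to_le (cvg_norm (u_l x))).
  by apply: filterS u_r => i; exact.
pose L : {scalar X} := HB.pack l (GRing.isLinear.Build R X R *%R l l_lin).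
have L_cont : continuous (L : X -> R).
  move=> x; apply/cvgrPdist_le => e e0.
  near=> y; rewrite -linearB (le_trans (l_r _))//.
  have : `|x - y| <= e / (`|r| + 1).
    by near: y; apply: cvgr_dist_le => //; rewrite divr_gt0// ltr_wpDl.
  rewrite ler_pdivlMr ?ltr_wpDl// mulrC; apply: le_trans.
  by rewrite ler_wpM2r// (le_trans (ler_norm _))// lerDl.
by exists (Dual L_cont).
Unshelve. all: by end_near. Qed.

End dual_norm.

(** * Stability of quantiles along an ultrafilter *)

Section stability.
Context (R : realType) (X : normedModType R).

(** Weak convergence along an arbitrary filter, so that it applies both to the
    given sequence along an ultrafilter and to a constant sequence. *)
Definition weak_cvg_along (I : Type) (U : set_system I)
    (nu_ : I -> probability (borel X) R) (nu : probability (borel X) R) :=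
  forall f : X -> R, continuous f -> bounded_fun f ->
    \int[nu_ i]_x f x @[i --> U] --> \int[nu]_x f x.

Context (I : Type) (U : set_system I) (nu_ : I -> probability (borel X) R)
  (nu : probability (borel X) R) (u_ : I -> dual X) (y_ : I -> X) (r : R).
Context (UU : UltraFilter U) (nu_cvg : weak_cvg_along U nu_ nu) (r1 : r < 1)
  (u_r : \forall i \near U, forall x, `|u_ i x| <= r * `|x|)
  (y_quantile : \forall i \near U, geometric_quantile (nu_ i) (u_ i) (y_ i)).

(** At a quantile the objective is at most its value 0 at the origin, so the
    coercive lower bound controls the norm of the quantile. *)
Lemma near_quantile_bounded : exists M, \forall i \near U, `|y_ i| <= M.
Proof.
(* With far mass below (1 - r) / 4, the coefficient 1 - r - 2 * far mass of the
   lower bound is at least (1 - r) / 2. *)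
have [k far_k] : exists k, \int[nu]_x soft_far k x < (1 - r) / 4.
  have d0 : 0 < (1 - r) / 4 by rewrite divr_gt0// subr_gt0.
  have /(_ _)/filter_ex[k Hk] := cvgr_lt 0 (Rintegral_soft_far_cvg0 nu) _ d0.
  by exists k.
have {}/(_ _) far_near := cvgr_lt _ (nu_cvg (@soft_far_continuous _ _ k)
  (@soft_far_bounded _ _ k)) _ far_k.
exists (2 * k.+1%:R / ((1 - r) / 2)).
near=> i.
have ur : forall x, `|u_ i x| <= r * `|x| by near: i.
have := quantile_objective_ge (nu_ i) k (y_ i) ur.
have /(_ 0) : geometric_quantile (nu_ i) (u_ i) (y_ i) by near: i.
rewrite quantile_objective0 ler_pdivlMr; last by rewrite divr_gt0// subr_gt0.
have : 0 <= ((1 - r) / 4 - \int[nu_ i]_x soft_far k x) * `|y_ i|.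
  rewrite mulr_ge0 ?normr_ge0// subr_ge0; apply: ltW.
  by near: i; exact: far_near.
lra.
Unshelve. all: by end_near. Qed.

Lemma quantile_objective_cvg (u : dual X) (z : X) :
  (forall x, u_ i x @[i --> U] --> u x) ->
  quantile_objective (nu_ i) (u_ i) z @[i --> U] --> quantile_objective nu u z.
Proof.
move=> u_u; apply: cvgB; last exact: u_u.
apply: nu_cvg; [exact: dist_gain_continuous|exact: dist_gain_bounded].
Qed.

(** Minimality of [y_ i] passes to the limit after replacing the moving point
    [y_ i] by its limit [y], at the cost (1 + r) |y - y_ i|. *)
Lemma geometric_quantile_limit (u : dual X) (y : X) :
  (forall x, u_ i x @[i --> U] --> u x) -> y_ @ U --> y ->
  geometric_quantile nu u y.
Proof.
move=> u_u y_y z.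
rewrite -subr_le0.
apply: (@cvgr_to_le _ U _ _ (fun i => quantile_objective (nu_ i) (u_ i) y
  - (quantile_objective (nu_ i) (u_ i) z + (1 + r) * `|y - y_ i|))).
- apply: cvgB; first exact: quantile_objective_cvg.
  rewrite -[X in _ --> X]addr0; apply: cvgD.
    exact: quantile_objective_cvg.
  rewrite -[X in _ --> X](mulr0 (1 + r)); apply: cvgMl_tmp.
  rewrite -(@normr0 _ X) -(subrr y); apply: cvg_norm; apply: cvgB => //.
  exact: cvg_cst.
- near=> i.
  have ur : forall x, `|u_ i x| <= r * `|x| by near: i.
  rewrite subr_le0 (le_trans (quantile_objective_le (nu_ i) y (y_ i) ur))//.
  rewrite lerD2r.
  have : geometric_quantile (nu_ i) (u_ i) (y_ i) by near: i.
  exact.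
Unshelve. all: by end_near. Qed.

Lemma near_quantile_cvg (u : dual X) : finite_dimensional X ->
  (forall x, u_ i x @[i --> U] --> u x) ->
  exists2 y, geometric_quantile nu u y & y_ @ U --> y.
Proof.
move=> finX u_u; have [M y_M] := near_quantile_bounded.
have [y _ y_y] := compact_ultra_cvg UU
  (@closed_norm_ball_compact _ X M finX) y_M.
by exists y => //; exact: geometric_quantile_limit.
Qed.

End stability.

(** * Uniform convergence *)

(** If the supremum stayed above [e] frequently, some ultrafilter would contain
    the set of bad indices, and choosing at each of them a parameter where [g]
    exceeds [e] would contradict the hypothesis. *)
Lemma nneg_sup_ultra_cvg0 (R : realType) (T : Type) (A : nat -> set T)
    (g : nat -> T -> R) :
  (forall U : set_system nat, UltraFilter U -> \oo `<=` U ->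
   forall t : nat -> T, (\forall n \near U, A n (t n)) ->
     g n (t n) @[n --> U] --> 0) ->
  nneg_sup [set (g n t)%:E | t in A n] @[n --> \oo] --> 0%E.
Proof.
move=> g0.
have small e : 0 < e -> \forall n \near \oo, forall t, A n t -> g n t <= e.
  move=> e0; pose P := [set n | forall t, A n t -> g n t <= e].
  apply: (@near_ultra _ _ P) => U UU ooU.
  have [//|UPn] := in_ultra_setVsetC P UU.
  have bad n : (~` P) n -> exists2 t, A n t & e < g n t.
    move=> nPn; apply: contrapT => nbad; apply: nPn => t Ant.
    by rewrite leNgt; apply/negP => egt; apply: nbad; exists t.
  (* [t0] provides a value of [t] at the indices that are not bad. *)
  have [n0 /bad[t0 _ _]] := filter_ex UPn.
  have /choice[t tP] n : exists t, (~` P) n -> A n t /\ e < g n t.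
    have [/bad[t ? ?]|?] := pselect ((~` P) n); first by exists t.
    by exists t0.
  have /(g0 U UU ooU) gt0 : \forall n \near U, A n (t n).
    by apply: filterS UPn => n /tP[].
  have [n [/tP[_ egn]]] := filter_ex (filterI UPn (cvgr_le 0 gt0 _ e0)).
  by move=> /(lt_le_trans egn); rewrite ltxx.
have sup_ge0 n : (0 <= nneg_sup [set (g n t)%:E | t in A n])%E.
  by apply: ereal_sup_ubound; left.
have sup_le e : 0 < e ->
    \forall n \near \oo, (nneg_sup [set (g n t)%:E | t in A n] <= e%:E)%E.
  move=> e0; apply: filterS (small e e0) => n gn.
  apply: ge_ereal_sup => _ [->|[t Ant <-]]; rewrite lee_fin; first exact: ltW.
  exact: gn.
have sup_fin : \forall n \near \oo,
    nneg_sup [set (g n t)%:E | t in A n] \is a fin_num.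
  apply: filterS (sup_le 1 ltr01) => n sup1.
  by rewrite ge0_fin_numE// (le_lt_trans sup1)// ltry.
apply/fine_cvgP; split => //; apply/cvgrPdist_le => e e0.
near=> n; rewrite sub0r normrN/= ger0_norm ?fine_ge0//.
rewrite -lee_fin fineK; last by near: n.
by near: n; exact: sup_le.
Unshelve. all: by end_near. Qed.

Theorem lemma4p18 (R : realType) (X : completeNormedModType R)
    (finX : finite_dimensional X)
    (mu_ : nat -> probability (borel X) R) (mu : probability (borel X) R)
    (mu_cvg : weak_cvg mu_ mu)
    (ystar : dual X -> X)
    (ystar_unique : forall u : dual X, dual_norm u < 1 ->
      unique (geometric_quantile mu u) (ystar u))
    (ystar_ : nat -> dual X -> X)
    (ystar_quantile : forall (n : nat) (u : dual X), dual_norm u < 1 ->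
      geometric_quantile (mu_ n) u (ystar_ n u)) :
  (forall eps : R, 0 < eps ->
    (fun n : nat => nneg_sup
      [set `|ystar_ n u - ystar u|%:E
         | u in [set u : dual X | dual_norm u < 1 - eps]])
      @ \oo --> 0%E)
  /\
  (atomless mu ->
    forall (c : nat -> R), (forall n, 0 <= c n) -> c @ \oo --> 0 ->
    forall v : dual X, dual_norm v < 1 ->
    (fun n : nat => nneg_sup
      [set `|ystar_ n u - ystar v|%:E
         | u in [set u : dual X | dual_norm (u \- v) <= c n]])
      @ \oo --> 0%E).
Proof.
(* Stated for general measures [nu_] and quantile maps [z_] because it is used
   both for [mu_], [ystar_] and for the constant [mu], [ystar]. *)
have ultra_cvg (U : set_system nat) (nu_ : nat -> probability (borel X) R)
    (z_ : nat -> dual X -> X) (u_ : nat -> dual X) (u : dual X) (r : R) :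
    UltraFilter U -> weak_cvg_along U nu_ mu ->
    (forall n (w : dual X), dual_norm w < 1 ->
      geometric_quantile (nu_ n) w (z_ n w)) ->
    0 <= r -> r < 1 -> (\forall n \near U, forall x, `|u_ n x| <= r * `|x|) ->
    (forall x, u_ n x @[n --> U] --> u x) -> dual_norm u < 1 ->
    z_ n (u_ n) @[n --> U] --> ystar u.
  move=> UU nu_U z_quantile r0 r1 u_r u_u u1.
  have [|y yq z_y] := near_quantile_cvg UU nu_U r1 u_r
    (y_ := fun n => z_ n (u_ n)) _ finX u_u.
    apply: filterS u_r => n ur; apply: z_quantile.
    by rewrite (le_lt_trans _ r1)// dual_norm_le.
  by rewrite ((ystar_unique u u1).2 y yq).
have mu_cvg_ultra (U : set_system nat) : \oo `<=` U -> weak_cvg_along U mu_ mu.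
  by move=> ooU f cf bf Q /(mu_cvg f cf bf); exact: ooU.
split=> [eps eps0|_ c c0 c_cvg v v1].
- apply: nneg_sup_ultra_cvg0 => U UU ooU u_ u_A.
  have r0 : 0 <= 1 - eps.
    have [n un] := filter_ex u_A.
    by rewrite (le_trans (dual_norm_ge0 (u_ n)))// ltW.
  have r1 : 1 - eps < 1 by rewrite gtrBl.
  have u_r : \forall n \near U, forall x, `|u_ n x| <= (1 - eps) * `|x|.
    apply: filterS u_A => n un x.
    rewrite (le_trans (dual_normP x (@dual_continuous _ _ (u_ n))))//.
    by rewrite ler_wpM2r// ltW.
  have [u ur u_u] := dual_ultra_limit UU u_r.
  have u1 : dual_norm u < 1 by rewrite (le_lt_trans _ r1)// dual_norm_le.
  rewrite -(@normr0 _ X) -(subrr (ystar u)).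
  apply: cvg_norm; apply: cvgB.
    exact: (ultra_cvg U mu_ ystar_ u_ u (1 - eps) UU (mu_cvg_ultra U ooU)).
  apply: (ultra_cvg U (fun=> mu) (fun=> ystar) u_ u (1 - eps)) => //.
    by move=> f _ _; exact: cvg_cst.
  by move=> _ w /ystar_unique[].
- apply: nneg_sup_ultra_cvg0 => U UU ooU u_ u_A.
  have v0 := dual_norm_ge0 v.
  (* Halfway between |v| and 1, so that |u_n| <= |v| + c_n <= r for late n. *)
  pose r := (1 + dual_norm v) / 2.
  have r0 : 0 <= r by rewrite divr_ge0// addr_ge0.
  have r1 : r < 1 by rewrite ltr_pdivrMr// mul1r; lra.
  have cU : c @ U --> (0 : R) by move=> Q /c_cvg; exact: ooU.
  have u_v : \forall n \near U, forall x, `|u_ n x - v x| <= c n * `|x|.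
    apply: filterS u_A => n un x.
    by rewrite (le_trans (dual_normBP _ _ _))// ler_wpM2r.
  have u_r : \forall n \near U, forall x, `|u_ n x| <= r * `|x|.
    have cr : \forall n \near U, c n <= r - dual_norm v.
      by apply: (cvgr_le 0 cU); rewrite subr_gt0 /r ltr_pdivlMr//; lra.
    near=> n => x.
    rewrite -(subrK (v x) (u_ n x)) (le_trans (ler_normD _ _))//.
    rewrite -(subrK (dual_norm v) r) mulrDl lerD//; last first.
      exact: dual_normP (@dual_continuous _ _ v).
    have /le_trans-> // : `|u_ n x - v x| <= c n * `|x| by move: x; near: n.
    by rewrite ler_wpM2r//; near: n.
  have u_cvg x : u_ n x @[n --> U] --> v x.
    apply/subr_cvg0/norm_cvg0P.
    apply: (@squeeze_cvgr _ _ _ _ (cst 0) (fun n => c n * `|x|)).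
    - by apply: filterS u_v => n un; rewrite normr_ge0 un.
    - exact: cvg_cst.
    - by rewrite -[X in _ --> X](mul0r `|x|); apply: cvgMr_tmp.
  rewrite -(@normr0 _ X) -(subrr (ystar v)).
  apply: cvg_norm; apply: cvgB; last exact: cvg_cst.
  exact: (ultra_cvg U mu_ ystar_ u_ v r UU (mu_cvg_ultra U ooU)).
Unshelve. all: by end_near. Qed.
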